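(* Let $F:(M,I,J,K,g_M)\to(N,g_N)$ be an h-semi-slant Riemannian map from a hyperkähler manifold to a Riemannian manifold such that $(I,J,K)$ is an h-semi-slant basis, with associated orthogonal decomposition $\ker F_*=\mathcal{D}_1\oplus\mathcal{D}_2$. Then the following conditions are equivalent: a) the (slant) distribution $\mathcal{D}_2$ is integrable; b) $P_I(\widehat{\nabla}_X\phi_I Y-\widehat{\nabla}_Y\phi_I X+\mathcal{T}_X\omega_I Y-\mathcal{T}_Y\omega_I X)=0$ for all $X,Y\in\Gamma(\mathcal{D}_2)$; c) $P_J(\widehat{\nabla}_X\phi_J Y-\widehat{\nabla}_Y\phi_J X+\mathcal{T}_X\omega_J Y-\mathcal{T}_Y\omega_J X)=0$ for all $X,Y\in\Gamma(\mathcal{D}_2)$; d) $P_K(\widehat{\nabla}_X\phi_K Y-\widehat{\nabla}_Y\phi_K X+\mathcal{T}_X\omega_K Y-\mathcal{T}_Y\omega_K X)=0$ for all $X,Y\in\Gamma(\mathcal{D}_2)$.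
   Context: All manifolds and maps are $C^\infty$; $\Gamma(\cdot)$ denotes smooth sections. A hyperkähler manifold $(M,I,J,K,g_M)$ is a Riemannian manifold with globally defined endomorphism fields $I,J,K$ of $TM$, each parallel for the Levi-Civita connection $\nabla$ of $g_M$, satisfying $I^2=J^2=K^2=-\mathrm{id}$, $IJ=-JI=K$, $JK=-KJ=I$, $KI=-IK=J$, and $g_M(RX,RY)=g_M(X,Y)$ for $R\in\{I,J,K\}$. A map $F:(M,g_M)\to(N,g_N)$ is a Riemannian map if for every $p\in M$ the differential $(F_* )_p$ restricted to $(\ker (F_* )_p)^\perp$ is a linear isometry onto the image of $(F_* )_p$ (with metric induced from $g_N$). Elements of $\Gamma(\ker F_* )$ are called vertical, elements of $\Gamma((\ker F_* )^\perp)$ horizontal. $F$ is an h-semi-slant Riemannian map with h-semi-slant basis $(I,J,K)$ if it is a Riemannian map and there is a distribution $\mathcal{D}_1\subset\ker F_*$ such that, with $\mathcal{D}_2$ the orthogonal complement of $\mathcal{D}_1$ in $\ker F_*$, for every $R\in\{I,J,K\}$ one has $R(\mathcal{D}_1)=\mathcal{D}_1$ and the angle $\theta_R$ between $RX$ and the space $(\mathcal{D}_2)_q$ is constant for all nonzero $X\in(\mathcal{D}_2)_q$ and all $q$. For $R\in\{I,J,K\}$: for $X\in\Gamma(\ker F_* )$ write $X=P_RX+Q_RX$ with $P_RX\in\Gamma(\mathcal{D}_1)$, $Q_RX\in\Gamma(\mathcal{D}_2)$, and $RX=\phi_RX+\omega_RX$ with $\phi_RX$ vertical and $\omega_RX$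 horizontal. Let $\mathcal{V},\mathcal{H}$ be the orthogonal projections of $TM$ onto $\ker F_*$ and $(\ker F_* )^\perp$. Define $\mathcal{T}_{E}G=\mathcal{H}\nabla_{\mathcal{V}E}\mathcal{V}G+\mathcal{V}\nabla_{\mathcal{V}E}\mathcal{H}G$ for $E,G\in\Gamma(TM)$, and $\widehat{\nabla}_XY=\mathcal{V}\nabla_XY$ for $X,Y\in\Gamma(\ker F_* )$. *)

(* Defs.v *)
From mathcomp Require Import all_boot all_order all_algebra.
From mathcomp Require Import all_classical all_reals all_analysis.

Set Implicit Arguments.
Unset Strict Implicit.
Unset Printing Implicit Defensive.
Import Order.TTheory GRing.Theory Num.Theory.
Import numFieldNormedType.Exports.

Local Open Scope classical_set_scope.
Local Open Scope ring_scope.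

Fixpoint iter_derive (R : realType) (V W : normedModType R) (vs : seq V)
    (f : V -> W) : V -> W :=
  if vs is v :: vs' then (fun x => 'D_v (iter_derive vs' f) x) else f.

(* C^oo on U, which is meant to be open: only the germs of f at the points
   of U matter then. *)
Definition smooth_on (R : realType) (V W : normedModType R) (U : set V)
    (f : V -> W) :=
  forall (vs : seq V) (x : V), U x -> differentiable (iter_derive vs f) x.

(* A manifold of dimension n with an atlas of charts chart a : dom a -> R^n,
   with inverses param a.
   The tangent space at p is represented by R^n through the chart base p: the
   row vector v stands for the tangent vector at p whose components in the
   chart base p are v.  Nothing is required of p |-> base p apart from
   p \in dom (base p). *)
Record manifold (R : realType) (n : nat) := Manifold {
  points :> topologicalType;
  manifold_hausdorff : hausdorff_space points;
  manifold_countable : @second_countable points;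
  chart_index : Type;
  dom : chart_index -> set points;
  chart : chart_index -> points -> 'rV[R]_n;
  param : chart_index -> 'rV[R]_n -> points;
  dom_open : forall a, open (dom a);
  chart_open : forall a, open (chart a @` dom a);
  chartK : forall a p, dom a p -> param a (chart a p) = p;
  chart_continuous : forall a p, dom a p -> {for p, continuous (chart a)};
  param_continuous : forall a x, (chart a @` dom a) x ->
    {for x, continuous (param a)};
  transition_smooth : forall a b,
    smooth_on (chart a @` (dom a `&` dom b)) (chart b \o param a);
  base : points -> chart_index;
  baseP : forall p, dom (base p) p }.

Arguments dom {R n m}.
Arguments chart {R n m}.
Arguments param {R n m}.
Arguments base {R n m}.

Section VectorFields.
Variables (R : realType) (n : nat) (M : manifold R n).

Definition vfield := M -> 'rV[R]_n.

Definition smooth_fun (f : M -> R) :=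
  forall a, smooth_on (chart a @` dom a) (f \o param a).

Definition in_chart (a : chart_index M) (X : vfield) : 'rV[R]_n -> 'rV[R]_n :=
  fun x => let p := param a x in
    'd (chart a \o param (base p)) (chart (base p) p) (X p).

(* The field with constant components v in the chart a, only meaningful on
   dom a. *)
Definition coord_field (a : chart_index M) (v : 'rV[R]_n) : vfield :=
  fun p => 'd (chart (base p) \o param a) (chart a p) v.

Definition smooth_field_on (U : set M) (X : vfield) :=
  forall a, smooth_on (chart a @` (dom a `&` U)) (in_chart a X).

Definition smooth_field := smooth_field_on setT.

Definition smooth_endo (A : M -> 'End('rV[R]_n)) :=
  forall a v, smooth_field_on (dom a) (fun p => A p (coord_field a v p)).

Definition field_deriv (X : vfield) (f : M -> R) : M -> R :=
  fun p => 'd (f \o param (base p)) (chart (base p) p) (X p).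

Definition lie_bracket (X Y : vfield) : vfield := fun p =>
  let a := base p in let x := chart a p in
  'd (in_chart a Y) x (in_chart a X x) - 'd (in_chart a X) x (in_chart a Y x).

(* A smooth subbundle; its rank is locally constant. *)
Definition distribution (D : M -> {vspace 'rV[R]_n}) :=
  forall p, exists (U : set M) (k : nat) (e : 'I_k -> vfield),
    [/\ open_nbhs p U,
        forall i, smooth_field_on U (e i)
      & forall q, U q -> basis_of (D q) [tuple e i q | i < k]].

Definition section_of (D : M -> {vspace 'rV[R]_n}) (X : vfield) :=
  smooth_field X /\ forall p, X p \in D p.

Definition integrable_distribution (D : M -> {vspace 'rV[R]_n}) :=
  forall X Y, section_of D X -> section_of D Y -> section_of D (lie_bracket X Y).

End VectorFields.

Record riemannian (R : realType) (n : nat) := Riemannian {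
  riem_manifold :> manifold R n;
  metric : riem_manifold -> {dot 'rV[R]_n for idfun};
  metric_smooth : forall a v w, smooth_on (chart a @` dom a)
    ((fun p => metric p (coord_field a v p) (coord_field a w p) : R)
       \o param a) }.

Section Riemannian.
Variables (R : realType) (n : nat) (M : riemannian R n).

(* nabla is only constrained on smooth fields, where the axioms determine it. *)
Record levi_civita (nabla : vfield M -> vfield M -> vfield M) : Prop := {
  nabla_smooth : forall X Y, smooth_field X -> smooth_field Y ->
    smooth_field (nabla X Y);
  nablaDl : forall X X' Y,
    smooth_field X -> smooth_field X' -> smooth_field Y ->
    forall p, nabla (fun q => X q + X' q) Y p = nabla X Y p + nabla X' Y p;
  nablaZl : forall f X Y,
    smooth_fun f -> smooth_field X -> smooth_field Y ->
    forall p, nabla (fun q => f q *: X q) Y p = f p *: nabla X Y p;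
  nablaDr : forall X Y Y',
    smooth_field X -> smooth_field Y -> smooth_field Y' ->
    forall p, nabla X (fun q => Y q + Y' q) p = nabla X Y p + nabla X Y' p;
  nabla_leibniz : forall f X Y,
    smooth_fun f -> smooth_field X -> smooth_field Y ->
    forall p, nabla X (fun q => f q *: Y q) p
              = field_deriv X f p *: Y p + f p *: nabla X Y p;
  nabla_torsion_free : forall X Y, smooth_field X -> smooth_field Y ->
    forall p, nabla X Y p - nabla Y X p = lie_bracket X Y p;
  nabla_metric : forall X Y Z,
    smooth_field X -> smooth_field Y -> smooth_field Z ->
    forall p, field_deriv X (fun q => metric q (Y q) (Z q)) p
              = metric p (nabla X Y p) (Z p) + metric p (Y p) (nabla X Z p) }.

Definition parallel (nabla : vfield M -> vfield M -> vfield M)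
    (A : M -> 'End('rV[R]_n)) :=
  forall X Y, smooth_field X -> smooth_field Y ->
    forall p, nabla X (fun q => A q (Y q)) p = A p (nabla X Y p).

Definition isometric (A : M -> 'End('rV[R]_n)) :=
  forall p u v, metric p (A p u) (A p v) = metric p u v.

Record hyperkahler (nabla : vfield M -> vfield M -> vfield M)
    (I J K : M -> 'End('rV[R]_n)) : Prop := {
  hk_smooth : [/\ smooth_endo I, smooth_endo J & smooth_endo K];
  hk_parallel : [/\ parallel nabla I, parallel nabla J & parallel nabla K];
  hk_square : forall p v,
    [/\ I p (I p v) = - v, J p (J p v) = - v & K p (K p v) = - v];
  hk_IJ : forall p v, I p (J p v) = K p v /\ - J p (I p v) = K p v;
  hk_JK : forall p v, J p (K p v) = I p v /\ - K p (J p v) = I p v;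
  hk_KI : forall p v, K p (I p v) = J p v /\ - I p (K p v) = J p v;
  hk_metric : [/\ isometric I, isometric J & isometric K] }.

Definition orth (p : M) (U : {vspace 'rV[R]_n}) : {vspace 'rV[R]_n} :=
  orthov (metric p) U.

Definition norm_at (p : M) (v : 'rV[R]_n) : R := Num.sqrt (metric p v v).

(* The angle, in [0, pi/2], between v != 0 and its orthogonal projection
   onto U. *)
Definition angle (p : M) (v : 'rV[R]_n) (U : {vspace 'rV[R]_n}) : R :=
  acos (norm_at p (daddv_pi U (orth p U) v) / norm_at p v).

End Riemannian.

Section RiemannianMaps.
Variables (R : realType) (m n : nat) (M : riemannian R m) (N : riemannian R n).
Variable F : M -> N.

Definition smooth_map := continuous F /\ forall a b,
  smooth_on (chart a @` (dom a `&` (F @^-1` dom b)))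
            (chart b \o F \o param a).

Definition pushforward (p : M) : 'Hom('rV[R]_m, 'rV[R]_n) :=
  linfun ('d (chart (base (F p)) \o F \o param (base p)) (chart (base p) p)).

Definition vertical (p : M) : {vspace 'rV[R]_m} := lker (pushforward p).
Definition horizontal (p : M) : {vspace 'rV[R]_m} := orth p (vertical p).

Definition riemannian_map :=
  smooth_map /\ forall p,
    (forall u v, u \in horizontal p -> v \in horizontal p ->
       metric (F p) (pushforward p u) (pushforward p v) = metric p u v) /\
    (pushforward p @: horizontal p = limg (pushforward p))%VS.

Definition slant_part (D1 : M -> {vspace 'rV[R]_m}) (p : M) :=
  (vertical p :&: orth p (D1 p))%VS.

Definition semi_slant_for (D1 : M -> {vspace 'rV[R]_m})
    (A : M -> 'End('rV[R]_m)) :=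
  (forall p, (A p @: D1 p)%VS = D1 p) /\
  exists theta : R, forall p u, u \in slant_part D1 p -> u != 0 ->
    angle p (A p u) (slant_part D1 p) = theta.

Definition h_semi_slant (I J K : M -> 'End('rV[R]_m))
    (D1 : M -> {vspace 'rV[R]_m}) :=
  [/\ riemannian_map, distribution D1, (forall p, (D1 p <= vertical p)%VS)
    & [/\ semi_slant_for D1 I, semi_slant_for D1 J & semi_slant_for D1 K]].

Definition vproj (X : vfield M) : vfield M :=
  fun p => daddv_pi (vertical p) (horizontal p) (X p).
Definition hproj (X : vfield M) : vfield M :=
  fun p => daddv_pi (horizontal p) (vertical p) (X p).

(* On vertical fields: the components along D1 and its complement D2. *)
Definition proj_D1 (D1 : M -> {vspace 'rV[R]_m}) (X : vfield M) : vfield M :=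
  fun p => daddv_pi (D1 p) (slant_part D1 p) (X p).

Definition phi (A : M -> 'End('rV[R]_m)) (X : vfield M) : vfield M :=
  vproj (fun p => A p (X p)).
Definition omega (A : M -> 'End('rV[R]_m)) (X : vfield M) : vfield M :=
  hproj (fun p => A p (X p)).

Variable nabla : vfield M -> vfield M -> vfield M.

Definition tensorT (X Y : vfield M) : vfield M := fun p =>
  hproj (nabla (vproj X) (vproj Y)) p + vproj (nabla (vproj X) (hproj Y)) p.

Definition nabla_hat (X Y : vfield M) : vfield M := vproj (nabla X Y).

Definition slant_condition (D1 : M -> {vspace 'rV[R]_m})
    (A : M -> 'End('rV[R]_m)) :=
  forall X Y, section_of (slant_part D1) X -> section_of (slant_part D1) Y ->
  forall p,
    proj_D1 D1 (fun q =>
      nabla_hat X (phi A Y) q - nabla_hat Y (phi A X) q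
      + tensorT X (omega A Y) q - tensorT Y (omega A X) q) p = 0.

End RiemannianMaps.

(* Main.v *)
From HB Require Import structures.
From mathcomp Require Import all_boot all_order all_algebra.
From mathcomp Require Import all_classical all_reals all_analysis.
From mathcomp Require Import ring lra.
Require Import Defs.

(** Let A be one of I, J, K, and let X, Y be sections of the slant bundle
    D2.  Because A is parallel and the connection is torsion free,
      A [X, Y] = nabla_X (A Y) - nabla_Y (A X).
    Splitting A Y = phi Y + omega Y and A X = phi X + omega X and taking
    vertical parts, the expression inside P_A is exactly the vertical part of
    A [X, Y] ([slant_expression]).  The bracket Z = [X, Y] of vertical fields
    is vertical, so Z = Z1 + Z2 with Z1 in D1 and Z2 in D2.  As A is an
    isometry preserving D1, A Z1 stays in D1 and A Z2 is orthogonal to D1;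
    hence the D1-component of the vertical part of A Z is A Z1, which vanishes
    if and only if Z1 does, that is, if and only if Z lies in D2
    ([proj_D1_endo]).  Thus each of the three conditions is equivalent to
    integrability ([integrable_slant_condition]).

    Two points of analysis support this algebra.

    Splitting nabla_X (A Y) into nabla_X (phi Y) + nabla_X (omega Y) uses the
    axioms of a connection, so phi Y and omega Y have to be smooth: the
    horizontal projection must preserve smoothness.  Since F is a Riemannian
    map, the horizontal projection H is the composite of F_* with its metric
    adjoint:
      g_M (H X, v) = g_N (F_* X, F_* v)    ([metric_hproj]).
    The right-hand side is smooth whenever X and v are, and inverting the
    Gram matrix of the coordinate fields recovers H X
    ([smooth_field_by_metric], [smooth_hproj]).

    The bracket of two vertical fields is vertical because both are F-related
    to 0.  In coordinates: differentiate dF(X) = 0 along Y and dF(Y) = 0 along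
    X and subtract; the second derivatives of F cancel by their symmetry
    ([derive_comm], [diff_bracket_eq0], [lie_bracket_vertical]). *)

Set Implicit Arguments.
Unset Strict Implicit.
Unset Printing Implicit Defensive.
Import Order.TTheory GRing.Theory Num.Theory.
Import numFieldNormedType.Exports.

Local Open Scope classical_set_scope.
Local Open Scope ring_scope.

(** * Smooth maps between normed spaces *)

Section SmoothUpto.
Variable R : realType.
Implicit Types V W : normedModType R.

(** The difference of the two maps vanishes near x, so it is differentiable
    there with differential 0. *)
Lemma near_eq_differentiable V W (f g : V -> W) (x : V) :
  (\near x, f x = g x) -> differentiable f x -> differentiable g x.
Proof.
move=> fg df.
pose h := g - f.
have h0 : \forall y \near x, h y = 0.
  by apply: filterS fg => y fgy; rewrite -[LHS]/(g y - f y) fgy subrr.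
have hx : h x = 0 by exact: nbhs_singleton h0.
have lin0 : linear (0 : V -> W).
  by move=> a u v; rewrite -[LHS]/(0 : W) -[RHS]/(a *: 0 + 0 : W) scaler0 addr0.
pose Z : {linear V -> W} :=
  HB.pack (0 : V -> W) (GRing.isLinear.Build _ _ _ _ _ lin0).
have cZ : continuous Z by move=> y; exact: cst_continuous.
have e : h \o shift x = cst (h x) + Z +o_ (0 : V) id.
  apply/eqaddoP => _/posnumP[eps].
  have := h0; rewrite (near_shift 0 x) subr0 => h1.
  near=> y.
  have hy : (h \o shift x) y = 0 by near: y; exact: h1.
  rewrite -[X in `|X|]/((h \o shift x) y - (h x + 0)) hy hx addr0 subr0 normr0.
  by rewrite mulr_ge0.
have dh : differentiable h x.
  by apply/diff_locallyP; rewrite (diff_unique cZ e).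
have -> : g = f + h by rewrite /h addrC subrK.
exact: differentiableD.
Unshelve. all: by end_near. Qed.

Lemma near_eq_iter_derive V W (f g : V -> W) (vs : seq V) (x : V) :
  (\near x, f x = g x) ->
  \forall y \near x, iter_derive vs f y = iter_derive vs g y.
Proof.
move=> fg; elim: vs => [//|v vs IH] /=; have := near_join IH => {}IH.
by apply: filterS IH => y; exact: near_eq_derive.
Qed.

(** Truncating the order of differentiation makes the closure properties of
    smooth maps provable by induction: a derivative of a product or of a
    composite is built from factors that are smooth to one order less. *)
Definition smooth_upto (k : nat) V W (U : set V) (f : V -> W) :=
  forall vs x, (size vs <= k)%N -> U x -> differentiable (iter_derive vs f) x.

Lemma smooth_uptoP V W (U : set V) (f : V -> W) :
  smooth_on U f <-> forall k, smooth_upto k U f.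
Proof.
split=> [sf k vs x _|sf vs x Ux]; [exact: sf | exact: (sf (size vs))].
Qed.

Lemma smooth_upto_local k V W (U : set V) (f : V -> W) :
  (forall x, U x -> exists2 O : set V, open_nbhs x O &
     exists2 g, smooth_upto k O g & {in O, f =1 g}) ->
  smooth_upto k U f.
Proof.
move=> loc vs x svs Ux; have [B [oB Bx] [g sg fg]] := loc x Ux.
have nB : nbhs x B by exact: open_nbhs_nbhs.
apply: near_eq_differentiable (sg vs x svs Bx); apply: near_eq_iter_derive.
by apply: filterS nB => y By; rewrite fg ?inE.
Unshelve. all: by end_near. Qed.

Lemma smooth_on_local V W (U : set V) (f : V -> W) :
  (forall x, U x -> exists2 O : set V, open_nbhs x O &
     exists2 g, smooth_on O g & {in O, f =1 g}) ->
  smooth_on U f.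
Proof.
move=> loc; apply/smooth_uptoP => k; apply: smooth_upto_local => x /loc.
by case=> O xO [g /smooth_uptoP/(_ k) sg fg]; exists O => //; exists g.
Qed.

Lemma eq_smooth_upto k V W (U : set V) (f g : V -> W) : open U ->
  {in U, f =1 g} -> smooth_upto k U g -> smooth_upto k U f.
Proof.
by move=> oU fg sg; apply: smooth_upto_local => x Ux; exists U; [|exists g].
Qed.

Lemma eq_smooth_on V W (U : set V) (f g : V -> W) : open U ->
  {in U, f =1 g} -> smooth_on U g -> smooth_on U f.
Proof.
by move=> oU fg sg; apply: smooth_on_local => x Ux; exists U; [|exists g].
Qed.

Lemma smooth_on_sub V W (U O : set V) (f : V -> W) : O `<=` U ->
  smooth_on U f -> smooth_on O f.
Proof. by move=> OU sf vs x /OU; exact: sf. Qed.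

Lemma smooth_upto_le k l V W (U : set V) (f : V -> W) : (k <= l)%N ->
  smooth_upto l U f -> smooth_upto k U f.
Proof. by move=> kl sf vs x svs; apply: sf; exact: leq_trans kl. Qed.

Lemma iter_derive_rcons V W vs v (f : V -> W) :
  iter_derive (rcons vs v) f = iter_derive vs ('D_v f).
Proof. by elim: vs => [|u vs IH] //=; rewrite IH. Qed.

Lemma smooth_upto_diff k V W (U : set V) (f : V -> W) x :
  smooth_upto k U f -> U x -> differentiable f x.
Proof. by move=> sf Ux; exact: (sf [::]). Qed.

Lemma smooth_on_diff V W (U : set V) (f : V -> W) x :
  smooth_on U f -> U x -> differentiable f x.
Proof. by move=> sf Ux; exact: (sf [::]). Qed.

(** The induction step: peel off the innermost derivative. *)
Lemma smooth_uptoS k V W (U : set V) (f : V -> W) :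
  smooth_upto k.+1 U f <->
  (forall x, U x -> differentiable f x) /\ forall v, smooth_upto k U ('D_v f).
Proof.
split=> [sf|[df sdf] vs x].
  split=> [x|v vs x svs Ux]; first exact: smooth_upto_diff sf.
  by rewrite -iter_derive_rcons; apply: sf; rewrite ?size_rcons.
case/lastP: vs => [_|vs v]; first exact: df.
by rewrite size_rcons iter_derive_rcons => svs; exact: sdf.
Qed.

Lemma smooth_upto_derive k V W (U : set V) (f : V -> W) v :
  smooth_upto k.+1 U f -> smooth_upto k U ('D_v f).
Proof. by case/smooth_uptoS. Qed.

Lemma smooth_on_derive V W (U : set V) (f : V -> W) v :
  smooth_on U f -> smooth_on U ('D_v f).
Proof. by move=> sf vs x Ux; rewrite -iter_derive_rcons; exact: sf. Qed.

Lemma smooth_upto_cst k V W (U : set V) (c : W) : smooth_upto k U (cst c : V -> W).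
Proof.
elim: k c => [|k IH] c; first by move=> [|//] x _ _ /=; exact: differentiable_cst.
apply/smooth_uptoS; split=> [x _|v]; first exact: differentiable_cst.
have -> : 'D_v (cst c : V -> W) = cst 0 by apply/funext => x; rewrite derive_cst.
exact: IH.
Qed.

Lemma smooth_uptoD k V W (U : set V) (f g : V -> W) : open U ->
  smooth_upto k U f -> smooth_upto k U g -> smooth_upto k U (fun x => f x + g x).
Proof.
move=> oU; elim: k f g => [|k IH] f g sf sg.
  move=> [|//] x _ Ux /=.
  exact: differentiableD (smooth_upto_diff sf Ux) (smooth_upto_diff sg Ux).
have df x Ux : differentiable f x := @smooth_upto_diff _ _ _ _ _ x sf Ux.
have dg x Ux : differentiable g x := @smooth_upto_diff _ _ _ _ _ x sg Ux.
apply/smooth_uptoS; split=> [x Ux|v].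
  exact: differentiableD (df x Ux) (dg x Ux).
apply: eq_smooth_upto oU _ (IH _ _ (smooth_upto_derive v sf) (smooth_upto_derive v sg)).
by move=> x /[!inE] Ux; rewrite [LHS]deriveD//; apply: diff_derivable; auto.
Qed.

Lemma smooth_uptoM k V (U : set V) (f g : V -> R) : open U ->
  smooth_upto k U f -> smooth_upto k U g -> smooth_upto k U (fun x => f x * g x).
Proof.
move=> oU; elim: k f g => [|k IH] f g sf sg.
  move=> [|//] x _ Ux /=.
  exact: differentiableM (smooth_upto_diff sf Ux) (smooth_upto_diff sg Ux).
have df x Ux : differentiable f x := @smooth_upto_diff _ _ _ _ _ x sf Ux.
have dg x Ux : differentiable g x := @smooth_upto_diff _ _ _ _ _ x sg Ux.
apply/smooth_uptoS; split=> [x Ux|v].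
  exact: differentiableM (df x Ux) (dg x Ux).
have sf' := smooth_upto_le (leqnSn k) sf.
have sg' := smooth_upto_le (leqnSn k) sg.
apply: eq_smooth_upto oU _ (smooth_uptoD oU
  (IH _ _ sf' (smooth_upto_derive v sg)) (IH _ _ sg' (smooth_upto_derive v sf))).
by move=> x /[!inE] Ux; rewrite [LHS]deriveM//; apply: diff_derivable; auto.
Qed.

Lemma smooth_uptoV k V (U : set V) (f : V -> R) : open U ->
  (forall x, U x -> f x != 0) ->
  smooth_upto k U f -> smooth_upto k U (fun x => (f x)^-1).
Proof.
move=> oU f0; elim: k f f0 => [|k IH] f f0 sf.
  move=> [|//] x _ Ux /=.
  exact: differentiableV (smooth_upto_diff sf Ux) (f0 x Ux).
have df x Ux : differentiable f x := @smooth_upto_diff _ _ _ _ _ x sf Ux.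
apply/smooth_uptoS; split=> [x Ux|v].
  exact: differentiableV (df x Ux) (f0 x Ux).
have sV := IH f f0 (smooth_upto_le (leqnSn k) sf).
apply: eq_smooth_upto oU _ (smooth_uptoM oU
  (smooth_uptoM oU (@smooth_upto_cst k V R U (-1)) (smooth_uptoM oU sV sV))
  (smooth_upto_derive v sf)).
move=> x /[!inE] Ux; rewrite [LHS]deriveV//; [|exact: f0|exact/diff_derivable/df].
by rewrite mulN1r expr2 invfM.
Qed.

Lemma differentiable_rV V n (f : V -> 'rV[R]_n) x :
  (forall i, differentiable (fun y => f y 0 i) x) -> differentiable f x.
Proof.
move=> df; have -> : f = \sum_(i < n) (fun y => f y 0 i *: delta_mx 0 i).
  by apply/funext => y; rewrite fct_sumE [LHS]row_sum_delta.
by apply: differentiable_sum => i; exact: differentiableZl.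
Qed.

Lemma derive_rV V n (f : V -> 'rV[R]_n) x v i : differentiable f x ->
  'D_v f x 0 i = 'D_v (fun y => f y 0 i) x.
Proof. by move=> /diff_derivable df; rewrite derive_mx ?mxE. Qed.

Lemma differentiable_rV_coord V n (f : V -> 'rV[R]_n) x i :
  differentiable f x -> differentiable (fun y => f y 0 i) x.
Proof.
by move=> df; exact: (differentiable_comp df (differentiable_coord _ _ _)).
Qed.

Lemma smooth_upto_rV k V n (U : set V) (f : V -> 'rV[R]_n) : open U ->
  smooth_upto k U f <-> forall i, smooth_upto k U (fun x => f x 0 i).
Proof.
move=> oU; elim: k f => [|k IH] f; split=> sf.
- by move=> i [|//] x _ Ux; apply: differentiable_rV_coord (smooth_upto_diff sf Ux).
- by move=> [|//] x _ Ux; apply: differentiable_rV => i; exact: smooth_upto_diff (sf i) Ux.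
- move=> i; apply/smooth_uptoS; split=> [x Ux|v].
    exact: differentiable_rV_coord (smooth_upto_diff sf Ux).
  apply: eq_smooth_upto oU _ ((IH _).1 (smooth_upto_derive v sf) i).
  by move=> x /[!inE] Ux; rewrite -derive_rV//; exact: smooth_upto_diff sf Ux.
- have df x : U x -> differentiable f x.
    by move=> Ux; apply: differentiable_rV => i; exact: smooth_upto_diff (sf i) Ux.
  apply/smooth_uptoS; split=> // v; apply/IH => i.
  apply: eq_smooth_upto oU _ (smooth_upto_derive v (sf i)).
  by move=> x /[!inE] Ux; rewrite derive_rV//; exact: df.
Qed.

Lemma smooth_upto_sum k V (I : Type) (r : seq I) (P : pred I) (U : set V)
    (f : I -> V -> R) :
  open U -> (forall i, P i -> smooth_upto k U (f i)) ->
  smooth_upto k U (fun x => \sum_(i <- r | P i) f i x).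
Proof.
move=> oU sf; elim: r => [|i r IH].
  apply: eq_smooth_upto oU _ (@smooth_upto_cst k V R U 0).
  by move=> x _; rewrite big_nil.
have [Pi|Pi] := boolP (P i); last first.
  by apply: eq_smooth_upto oU _ IH => x _; rewrite big_cons (negPf Pi).
by apply: eq_smooth_upto oU _ (smooth_uptoD oU (sf i Pi) IH) => x _; rewrite big_cons Pi.
Qed.

Lemma diff_rV_sum n W (g : 'rV[R]_n -> W) (x v : 'rV[R]_n) : differentiable g x ->
  'd g x v = \sum_i v 0 i *: 'D_(delta_mx 0 i) g x.
Proof.
move=> dg; rewrite {1}[v]row_sum_delta linear_sum; apply: eq_bigr => i _.
by rewrite linearZ deriveE.
Qed.

(** The chain rule 'D_v (g o f) = sum_i ('D_v f)_i * ('D_(e_i) g o f) involves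
    composites of f with derivatives of g only, to which the induction
    hypothesis on k applies. *)
Lemma smooth_upto_comp k V n (U : set V) (O : set 'rV[R]_n)
    (f : V -> 'rV[R]_n) (g : 'rV[R]_n -> R) : open U -> open O ->
  (forall x, U x -> O (f x)) ->
  smooth_upto k U f -> smooth_upto k O g -> smooth_upto k U (g \o f).
Proof.
move=> oU oO fO; elim: k g => [|k IH] g sf sg.
  move=> [|//] x _ Ux /=; apply: differentiable_comp (smooth_upto_diff sf Ux) _.
  exact: smooth_upto_diff sg (fO x Ux).
have df x Ux : differentiable f x := @smooth_upto_diff _ _ _ _ _ x sf Ux.
have dg x Ux : differentiable g (f x) := smooth_upto_diff sg (fO x Ux).
apply/smooth_uptoS; split=> [x Ux|v]; first exact: differentiable_comp (df x Ux) (dg x Ux).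
have sf' := smooth_upto_le (leqnSn k) sf.
have /(smooth_upto_rV _ _ oU) sDf := smooth_upto_derive v sf.
pose T i x := 'D_v f x 0 i * ('D_(delta_mx 0 i) g \o f) x.
apply: (@eq_smooth_upto _ _ _ _ _ (fun x => \sum_i T i x)) => // [x /[!inE] Ux|].
  rewrite deriveE; last exact: differentiable_comp (df x Ux) (dg x Ux).
  rewrite diff_comp; [|exact: df|exact: dg].
  rewrite /= diff_rV_sum; last exact: dg.
  by apply: eq_bigr => i _; rewrite -deriveE//; exact: df.
apply: smooth_upto_sum => // i _; apply: smooth_uptoM => //.
exact: IH sf' (smooth_upto_derive _ sg).
Qed.

End SmoothUpto.

Section SmoothOn.
Variable R : realType.
Implicit Types V W : normedModType R.

Lemma smooth_on_cst V W (U : set V) (c : W) : smooth_on U (cst c : V -> W).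
Proof. by apply/smooth_uptoP => k; exact: smooth_upto_cst. Qed.

Lemma smooth_onD V W (U : set V) (f g : V -> W) : open U ->
  smooth_on U f -> smooth_on U g -> smooth_on U (fun x => f x + g x).
Proof.
move=> oU /smooth_uptoP sf /smooth_uptoP sg; apply/smooth_uptoP => k.
exact: smooth_uptoD.
Qed.

Lemma smooth_onM V (U : set V) (f g : V -> R) : open U ->
  smooth_on U f -> smooth_on U g -> smooth_on U (fun x => f x * g x).
Proof.
move=> oU /smooth_uptoP sf /smooth_uptoP sg; apply/smooth_uptoP => k.
exact: smooth_uptoM.
Qed.

Lemma smooth_onV V (U : set V) (f : V -> R) : open U ->
  (forall x, U x -> f x != 0) -> smooth_on U f ->
  smooth_on U (fun x => (f x)^-1).
Proof.
move=> oU f0 /smooth_uptoP sf; apply/smooth_uptoP => k; exact: smooth_uptoV.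
Qed.

Lemma smooth_on_rV V n (U : set V) (f : V -> 'rV[R]_n) : open U ->
  smooth_on U f <-> forall i, smooth_on U (fun x => f x 0 i).
Proof.
move=> oU; split=> [/smooth_uptoP sf i|sf]; apply/smooth_uptoP => k.
  exact: (smooth_upto_rV _ _ oU).1.
apply/(smooth_upto_rV _ _ oU) => i.
by have /smooth_uptoP := sf i; apply.
Qed.

Lemma smooth_on_sum V (I : Type) (r : seq I) (P : pred I) (U : set V)
    (f : I -> V -> R) : open U -> (forall i, P i -> smooth_on U (f i)) ->
  smooth_on U (fun x => \sum_(i <- r | P i) f i x).
Proof.
move=> oU sf; apply/smooth_uptoP => k; apply: smooth_upto_sum => // i Pi.
by have /smooth_uptoP := sf i Pi; apply.
Qed.

Lemma smooth_on_prod V (I : Type) (r : seq I) (P : pred I) (U : set V)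
    (f : I -> V -> R) : open U -> (forall i, P i -> smooth_on U (f i)) ->
  smooth_on U (fun x => \prod_(i <- r | P i) f i x).
Proof.
move=> oU sf; elim: r => [|i r IH].
  apply: eq_smooth_on oU _ (@smooth_on_cst V R U 1).
  by move=> x _; rewrite big_nil.
have [Pi|Pi] := boolP (P i); last first.
  by apply: eq_smooth_on oU _ IH => x _; rewrite big_cons (negPf Pi).
by apply: eq_smooth_on oU _ (smooth_onM oU (sf i Pi) IH) => x _; rewrite big_cons Pi.
Qed.

Lemma smooth_on_comp V n (U : set V) (O : set 'rV[R]_n)
    (f : V -> 'rV[R]_n) (g : 'rV[R]_n -> R) : open U -> open O ->
  (forall x, U x -> O (f x)) ->
  smooth_on U f -> smooth_on O g -> smooth_on U (g \o f).
Proof.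
move=> oU oO fO /smooth_uptoP sf /smooth_uptoP sg; apply/smooth_uptoP => k.
exact: (smooth_upto_comp oU oO).
Qed.

Lemma smooth_on_det V n (U : set V) (A : V -> 'M[R]_n) : open U ->
  (forall i j, smooth_on U (fun x => A x i j)) ->
  smooth_on U (fun x => \det (A x)).
Proof.
move=> oU sA; apply: smooth_on_sum => // s _; apply: smooth_onM => //.
  exact: smooth_on_cst.
exact: smooth_on_prod.
Qed.

(** Cramer's formula: the entries of the inverse are polynomials in the
    entries of A divided by the determinant. *)
Lemma smooth_on_invmx V n (U : set V) (A : V -> 'M[R]_n) : open U ->
  (forall x, U x -> A x \in unitmx) ->
  (forall i j, smooth_on U (fun x => A x i j)) ->
  forall i j, smooth_on U (fun x => invmx (A x) i j).
Proof.
move=> oU uA sA i j.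
have sadj : smooth_on U (fun x => \adj (A x) i j).
  have -> : (fun x => \adj (A x) i j) =
      (fun x => (-1) ^+ (j + i) * \det (row' j (col' i (A x)))).
    by apply/funext => x; rewrite mxE.
  apply: smooth_onM (smooth_on_cst _) _ => //; apply: smooth_on_det => // k l.
  apply: eq_smooth_on oU _ (sA (lift j k) (lift i l)).
  by move=> x _; rewrite !mxE.
have sdet : smooth_on U (fun x => (\det (A x))^-1).
  apply: smooth_onV => //; last exact: smooth_on_det.
  by move=> x Ux; rewrite -unitfE -unitmxE; exact: uA.
apply: eq_smooth_on oU _ (smooth_onM oU sdet sadj) => x /[!inE] Ux.
by rewrite /invmx uA// mxE.
Qed.

Lemma smooth_on_linear_solve V n (U : set V) (A : V -> 'M[R]_n)
    (c h : V -> 'rV[R]_n) : open U ->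
  (forall x, U x -> A x \in unitmx) ->
  (forall i j, smooth_on U (fun x => A x i j)) -> smooth_on U h ->
  (forall x, U x -> c x *m A x = h x) -> smooth_on U c.
Proof.
move=> oU uA sA /(smooth_on_rV _ oU) sh cA; apply/(smooth_on_rV _ oU) => j.
apply: (@eq_smooth_on _ _ _ _ _
   (fun x => \sum_i h x 0 i * invmx (A x) i j)) => // [x /[!inE] Ux|].
  by rewrite -[c x](mulmxK (uA x Ux)) cA// mxE.
apply: smooth_on_sum => // i _; apply: smooth_onM => //.
exact: smooth_on_invmx.
Qed.

Lemma smooth_on_diff_along m n (U : set 'rV[R]_m) (f : 'rV[R]_m -> 'rV[R]_n)
    (X : 'rV[R]_m -> 'rV[R]_m) : open U ->
  smooth_on U f -> smooth_on U X -> smooth_on U (fun x => 'd f x (X x)).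
Proof.
move=> oU sf /(smooth_on_rV _ oU) sX; apply/(smooth_on_rV _ oU) => j.
apply: (@eq_smooth_on _ _ _ _ _
   (fun x => \sum_i X x 0 i * 'D_(delta_mx 0 i) f x 0 j)) => // [x /[!inE] Ux|].
  rewrite diff_rV_sum; last exact: smooth_on_diff Ux.
  by rewrite summxE; apply: eq_bigr => i _; rewrite mxE.
apply: smooth_on_sum => // i _; apply: smooth_onM => //.
by have /(smooth_on_rV _ oU) := smooth_on_derive (delta_mx 0 i) sf; apply.
Qed.

(** * Symmetry of second derivatives *)

Lemma is_derive_line V (f : V -> R) (y v : V) (s : R) :
  differentiable f (s *: v + y) ->
  is_derive s 1 (fun t : R => f (t *: v + y)) ('D_v f (s *: v + y)).
Proof.
move=> df; pose l (t : R) := t *: v + y.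
have dl : is_diff s l (fun t => t *: v).
  have -> : l = ( *:%R ^~ v) + cst y by apply/funext.
  by apply: is_diff_eq; apply/funext => t; rewrite -[LHS]/(t *: v + 0) addr0.
have /differentiableP dfl : differentiable f (l s) by [].
have dfs : is_diff s (f \o l) ('d f (l s) \o (fun t => t *: v)) by exact: is_diff_comp.
have dc : differentiable (f \o l) s by case: dfs.
apply: DeriveDef; first exact: diff_derivable.
rewrite -[LHS]/('D_1 (f \o l) s) deriveE// deriveE//.
by case: dfs => _ ->; rewrite /= scale1r.
Qed.

(** The two orders of the middle terms of the second difference give two
    approximations of the same number. *)
Lemma second_difference_swap (s1 s2 s3 s4 a b q e : R) :
  `|s1 - s2 - s3 + s4 - q * a| <= e -> `|s1 - s3 - s2 + s4 - q * b| <= e ->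
  `|q * (a - b)| <= e + e.
Proof.
move=> ha hb.
have -> : q * (a - b) =
  (s1 - s3 - s2 + s4 - q * b) - (s1 - s2 - s3 + s4 - q * a) by ring.
by apply: (le_trans (ler_normB _ _)); exact: lerD.
Qed.

(** The second difference of f at x on the parallelogram spanned by t u and
    t v is t^2 'D_u ('D_v f) x up to o(t^2).  The mean value theorem along v
    reduces it to an increment of 'D_v f, which is differentiable at x.  The second
    difference is symmetric in u and v, whence [derive_comm]. *)
Lemma second_difference V (f : V -> R) (x u v : V) (e : R) : 0 < e ->
  (\near x, differentiable f x) -> differentiable ('D_v f) x ->
  \forall t \near (0 : R)^'+,
    `|f (t *: u + (t *: v + x)) - f (t *: u + x) - f (t *: v + x) + f x
      - t ^+ 2 * 'D_u ('D_v f) x| <= e * t ^+ 2.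
Proof.
move=> e0 df dg; set g := 'D_v f in dg *; set L := 'd g x.
(* Both endpoints t u + s v and s v, for 0 <= s <= t, contribute an error
   proportional to their norms, whose sum is at most t (|u| + 2 |v|). *)
pose C := `|u| + `|v| + `|v| + 1.
have C0 : 0 < C by rewrite /C; have := normr_ge0 u; have := normr_ge0 v; lra.
have eC : 0 < e / C by exact: divr_gt0.
have [d d0 dP] : exists2 d : R, 0 < d & forall h : V, `|h| < d ->
    differentiable f (h + x) /\ `|g (h + x) - g x - L h| <= e / C * `|h|.
  have dg1 := (diff_locallyP _ _).1 dg; case: dg1 => _ /eqaddoP/(_ _ eC) dg1.
  have df1 : \forall h \near (0 : V), differentiable f (h + x).
    by move: df; rewrite (near_shift 0 x) subr0.
  case: ((nbhs_ballP _ _).1 (filterI df1 dg1)) => d d0 dP.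
  exists d => // h hd; have [|? hP] := dP h; last split => //.
    by rewrite -ball_normE /= sub0r normrN.
  by move: hP; rewrite [X in `|X| <= _](_ : _ = g (h + x) - g x - L h)// opprD addrA.
have dC : 0 < d / C by exact: divr_gt0.
near=> t.
have t0 : 0 < t by near: t; exact: nbhs_right_gt.
have tdC : t < d / C by near: t; exact: nbhs_right_lt.
have tC : t * C < d by rewrite -ltr_pdivlMr.
have sm s (a : R) : 0 <= s <= t -> a = 0 \/ a = t ->
    `|a *: u + s *: v| <= t * `|u| + t * `|v|.
  move=> /andP[s0 st] aP; apply: (le_trans (ler_normD _ _)); rewrite !normrZ.
  rewrite (ger0_norm s0); apply: lerD; last exact: ler_wpM2r.
  by case: aP => ->; rewrite ?normr0 ?mul0r ?mulr_ge0 ?gtr0_norm// ltW.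
have smd s (a : R) : 0 <= s <= t -> a = 0 \/ a = t -> `|a *: u + s *: v| < d.
  move=> st aP; apply: (le_lt_trans (sm s a st aP)); apply: le_lt_trans tC.
  rewrite /C; have := mulr_ge0 (ltW t0) (normr_ge0 v); lra.
(* The second difference is p t - p 0. *)
pose p (s : R) := f (s *: v + (t *: u + x)) - f (s *: v + x).
have pD s : 0 <= s <= t ->
    is_derive s 1 p (g (s *: v + (t *: u + x)) - g (s *: v + x)).
  move=> st.
  have d1 : differentiable f (s *: v + (t *: u + x)).
    by rewrite addrCA addrA; apply: (dP _ _).1; apply: smd => //; right.
  have d2 : differentiable f (s *: v + x).
    by have := (dP _ (smd s 0 st (or_introl erefl))).1; rewrite scale0r add0r.
  have i1 := is_derive_line d1; have i2 := is_derive_line d2.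
  exact: is_deriveB.
have [c cI cE] : exists2 c, c \in `]0, t[%R &
    p t - p 0 = (g (c *: v + (t *: u + x)) - g (c *: v + x)) * (t - 0).
  apply: MVT => // [s|].
    by rewrite in_itv /= => /andP[s0 st]; apply: pD; rewrite !ltW.
  apply: derivable_within_continuous => s; rewrite in_itv /= => /andP[s0 st].
  by have [] := pD s; rewrite ?s0.
have ct : 0 <= c <= t by move: cI; rewrite in_itv /= => /andP[? ?]; rewrite !ltW.
have [_ b1] := dP _ (smd c t ct (or_intror erefl)).
have [_ b2] := dP _ (smd c 0 ct (or_introl erefl)).
have n1 := sm c t ct (or_intror erefl).
have n2 : `|0 *: u + c *: v| <= t * `|v|.
  rewrite scale0r add0r normrZ ler_wpM2r//.
  by case/andP: ct => c0 ct; rewrite ger0_norm.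
rewrite scale0r add0r in b2 n2.
set G1 := g (t *: u + c *: v + x) in b1.
set G2 := g (c *: v + x) in b2 cE.
have G1E : g (c *: v + (t *: u + x)) = G1 by rewrite addrCA addrA.
have LE : L (t *: u + c *: v) = t * L u + L (c *: v).
  by rewrite linearD linearZ.
have -> : f (t *: u + (t *: v + x)) - f (t *: u + x) - f (t *: v + x) + f x
    - t ^+ 2 * 'D_u g x =
    t * ((G1 - g x - L (t *: u + c *: v)) - (G2 - g x - L (c *: v))).
  have -> : f (t *: u + (t *: v + x)) - f (t *: u + x) - f (t *: v + x) + f x = p t - p 0.
    by rewrite /p !scale0r !add0r addrCA; ring.
  by rewrite cE G1E subr0 deriveE// LE -/L; ring.
rewrite normrM (gtr0_norm t0).
have -> : e * t ^+ 2 = t * (e * t) by ring.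
rewrite ler_pM2l//; apply: (le_trans (ler_normB _ _)).
apply: (le_trans (lerD b1 b2)).
rewrite -mulrDr -mulrA ler_pM2l// mulrC ler_pdivrMr//.
apply: (le_trans (lerD n1 n2)).
by rewrite /C; lra.
Unshelve. all: by end_near. Qed.

Lemma quarters_lt (a q : R) : 0 < a -> 0 < q -> a / 4 * q + a / 4 * q < q * a.
Proof.
move=> a0 q0; rewrite -mulrDl [ltRHS]mulrC (ltr_pM2r q0).
by lra.
Qed.

Lemma derive_comm V (f : V -> R) (x u v : V) :
  (\near x, differentiable f x) -> differentiable ('D_v f) x ->
  differentiable ('D_u f) x -> 'D_u ('D_v f) x = 'D_v ('D_u f) x.
Proof.
move=> df dv du; apply/eqP; rewrite -subr_eq0; apply/negP => /negP AB.
have e0 : 0 < `|'D_u ('D_v f) x - 'D_v ('D_u f) x| / 4.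
  by rewrite divr_gt0// normr_gt0.
have hA := second_difference u e0 df dv.
have hB := second_difference v e0 df du.
have [t [t0 [{}hA {}hB]]] :=
  filter_ex (filterI (nbhs_right_gt (0 : R)) (filterI hA hB)).
rewrite addrCA in hB.
have := second_difference_swap hA hB; apply/negP; rewrite -ltNge.
have t2 : 0 < t ^+ 2 by rewrite exprn_gt0.
rewrite normrM (gtr0_norm t2).
by apply: quarters_lt => //; rewrite normr_gt0.
Qed.

End SmoothOn.

(** * Charts and fields *)

Lemma near_eq_diff (R : realType) (V W : normedModType R) (f g : V -> W) (x : V) :
  (\near x, f x = g x) -> differentiable f x -> 'd f x =1 'd g x.
Proof.
move=> fg df v; have dg := near_eq_differentiable fg df.
by rewrite -!deriveE//; exact: near_eq_derive.
Qed.

Lemma diff_comp_at (R : realType) (U V W : normedModType R) (f : U -> V)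
    (g : V -> W) (x v : U) (y : V) : f x = y ->
  differentiable f x -> differentiable g y ->
  'd (g \o f) x v = 'd g y ('d f x v).
Proof. by move=> <- df dg; exact: (congr1 (@^~ v) (diff_comp df dg)). Qed.

Section Charts.
Variables (R : realType) (n : nat) (M : manifold R n).
Implicit Types (a b c : chart_index M) (p q : M) (X Y : vfield M).

Lemma chart_image_open a (U : set M) : open U ->
  open (chart a @` (dom a `&` U)).
Proof.
move=> oU; rewrite openE => _ [p [ap Up] <-].
have n1 : nbhs (chart a p) (chart a @` dom a).
  by apply: open_nbhs_nbhs; split; [exact: chart_open | exists p].
have n2 : nbhs (chart a p) (param a @^-1` U).
  apply: param_continuous; first by exists p.
  by rewrite chartK//; apply: open_nbhs_nbhs.
apply: filterS (filterI n1 n2) => _ [[q aq <-]] /=.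
by rewrite chartK// => Uq; exists q.
Qed.

(** What holds in the coordinates of all points of an open set near p holds
    near the coordinates of p; this is how identities between composites of
    charts become identities between germs. *)
Lemma near_chart a (U : set M) p (P : set 'rV[R]_n) : open U -> dom a p -> U p ->
  (forall q, dom a q -> U q -> P (chart a q)) -> \forall x \near chart a p, P x.
Proof.
move=> oU ap Up PP; have : nbhs (chart a p) (chart a @` (dom a `&` U)).
  by apply: open_nbhs_nbhs; split; [exact: chart_image_open | exists p].
by apply: filterS => _ [q [aq Uq] <-]; exact: PP.
Qed.

(** The change of coordinates of tangent vectors at p from chart a to
    chart b. *)
Definition dtrans a b p : {linear 'rV[R]_n -> 'rV[R]_n} :=
  'd (chart b \o param a) (chart a p).

Lemma transition_diff a b p : dom a p -> dom b p ->
  differentiable (chart b \o param a) (chart a p).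
Proof.
move=> ap bp; have h : (chart a @` (dom a `&` dom b)) (chart a p) by exists p.
exact: smooth_on_diff (@transition_smooth _ _ M a b) h.
Qed.

Lemma dtrans_id a p v : dom a p -> dtrans a a p v = v.
Proof.
move=> ap; transitivity ('d (id : 'rV[R]_n -> 'rV[R]_n) (chart a p) v); last first.
  by rewrite diff_val.
apply: near_eq_diff; last exact: (transition_diff ap ap).
by apply: (near_chart openT ap I) => q aq _ /=; rewrite chartK.
Qed.

Lemma dtrans_comp a b c p v : dom a p -> dom b p -> dom c p ->
  dtrans b c p (dtrans a b p v) = dtrans a c p v.
Proof.
move=> ap bp cp; have bE : (chart b \o param a) (chart a p) = chart b p.
  by rewrite /= chartK.
have dab := transition_diff ap bp; have dbc := transition_diff bp cp.
transitivity ('d ((chart c \o param b) \o (chart b \o param a)) (chart a p) v).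
  exact: esym (diff_comp_at v bE dab dbc).
apply: near_eq_diff; last by apply: differentiable_comp dab _; rewrite bE.
by apply: (near_chart (dom_open b) ap bp) => q aq bq /=; rewrite !chartK.
Qed.

Lemma in_chartE a X p : dom a p -> in_chart a X (chart a p) = dtrans (base p) a p (X p).
Proof. by move=> ap; rewrite /in_chart chartK. Qed.

Lemma coord_in_chart a X p : dom a p -> coord_field a (in_chart a X (chart a p)) p = X p.
Proof.
move=> ap; have bp := baseP p.
by rewrite in_chartE// -[LHS]/(dtrans a (base p) p _) dtrans_comp// dtrans_id.
Qed.

Lemma in_chart_coord a v p : dom a p -> in_chart a (coord_field a v) (chart a p) = v.
Proof.
move=> ap; have bp := baseP p.
by rewrite in_chartE// -/(dtrans a (base p) p _) dtrans_comp// dtrans_id.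
Qed.

Lemma coord_field_sum a v p :
  coord_field a v p = \sum_i v 0 i *: coord_field a (delta_mx 0 i) p.
Proof.
rewrite {1}[v]row_sum_delta /coord_field linear_sum.
by apply: eq_bigr => i _; rewrite linearZ.
Qed.

Lemma smooth_fieldP X : smooth_field X <->
  forall a, smooth_on (chart a @` dom a) (in_chart a X).
Proof. by rewrite /smooth_field /smooth_field_on; split=> h a; have := h a; rewrite setIT. Qed.

Lemma smooth_fieldB X Y : smooth_field X -> smooth_field Y ->
  smooth_field (fun p => X p - Y p).
Proof.
move=> /smooth_fieldP sX /smooth_fieldP sY; apply/smooth_fieldP => a.
have oa := @chart_open _ _ M a.
apply/(smooth_on_rV _ oa) => i.
have /(smooth_on_rV _ oa)/(_ i) sXi := sX a.
have /(smooth_on_rV _ oa)/(_ i) sYi := sY a.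
apply: eq_smooth_on oa _ (smooth_onD oa sXi
  (smooth_onM oa (@smooth_on_cst _ _ R _ (-1)) sYi)).
by move=> x _; rewrite /in_chart linearB !mxE mulN1r.
Qed.

(** On the domain of a chart, X is a combination of the coordinate fields
    with smooth coefficients, and smoothness of A is known on those. *)
Lemma smooth_endo_field (A : M -> 'End('rV[R]_n)) X :
  smooth_endo A -> smooth_field X -> smooth_field (fun p => A p (X p)).
Proof.
move=> sA /smooth_fieldP sX; apply/smooth_fieldP => a.
have oa := @chart_open _ _ M a; apply/(smooth_on_rV _ oa) => j.
have /(smooth_on_rV _ oa) sXi := sX a.
pose E i := in_chart a (fun p => A p (coord_field a (delta_mx 0 i) p)).
apply: (@eq_smooth_on _ _ _ _ _
    (fun x => \sum_i in_chart a X x 0 i * E i x 0 j)) => // [_ /[1!inE] -[p ap <-]|].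
  rewrite (in_chartE _ ap) -(coord_in_chart X ap) coord_field_sum !linear_sum summxE.
  apply: eq_bigr => i _.
  have -> : E i (chart a p) =
      dtrans (base p) a p (A p (coord_field a (delta_mx 0 i) p)).
    exact: in_chartE.
  by rewrite linearZ linearZ mxE.
apply: smooth_on_sum => // i _; apply: smooth_onM => //.
have := sA a (delta_mx 0 i) a; rewrite setIid => /(smooth_on_rV _ oa); exact.
Qed.

End Charts.

(** * Smoothness tested by the metric *)

Section Metric.
Variables (R : realType) (n : nat) (M : riemannian R n).
Implicit Types (X Y : vfield M).

Lemma metric_eq0 (p : M) u : metric p u u = 0 -> u = 0.
Proof.
move=> u0; apply: contrapT => /eqP /(neq0_dnorm_gt0 (s:=metric p)).
by rewrite u0 ltxx.
Qed.

(** The components of X in a chart solve the linear system whose matrix is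
    the Gram matrix of the coordinate fields, which is smooth and invertible. *)
Lemma smooth_field_by_metric X :
  (forall a v, smooth_on (chart a @` dom a)
     (fun x => metric (param a x) (X (param a x)) (coord_field a v (param a x)) : R)) ->
  smooth_field X.
Proof.
move=> sX; apply/smooth_fieldP => a.
have oa := @chart_open _ _ M a.
pose G x : 'M[R]_n := \matrix_(i, j) metric (param a x)
  (coord_field a (delta_mx 0 i) (param a x)) (coord_field a (delta_mx 0 j) (param a x)).
pose h x : 'rV[R]_n := \row_j
  metric (param a x) (X (param a x)) (coord_field a (delta_mx 0 j) (param a x)).
have GE p v j : dom a p -> (v *m G (chart a p)) 0 j =
    metric p (coord_field a v p) (coord_field a (delta_mx 0 j) p).
  move=> ap; rewrite mxE coord_field_sum linear_sumlz; apply: eq_bigr => i _.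
  by rewrite mxE chartK// linearZl_LR.
apply: (@smooth_on_linear_solve _ _ _ _ G _ h) => //.
- move=> _ [p ap <-]; rewrite -row_free_unit; apply: inj_row_free => v vG.
  rewrite -(in_chart_coord v ap) in_chartE//.
  suff -> : coord_field a v p = 0 by rewrite linear0.
  apply: (@metric_eq0 p); rewrite {2}coord_field_sum linear_sumr big1//= => i _.
  have gi : metric p (coord_field a v p) (coord_field a (delta_mx 0 i) p) = 0.
    by rewrite -(GE _ _ _ ap) vG mxE.
  by rewrite linearZr_LR /= gi mulr0.
- move=> i j; apply: eq_smooth_on oa _ (@metric_smooth _ _ M a (delta_mx 0 i) (delta_mx 0 j)).
  by move=> x _; rewrite mxE.
- apply/(smooth_on_rV _ oa) => j; apply: eq_smooth_on oa _ (sX a (delta_mx 0 j)).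
  by move=> x _; rewrite mxE.
- move=> _ [p ap <-]; apply/rowP => j; rewrite GE// mxE chartK//.
  by rewrite coord_in_chart.
Qed.

End Metric.

(** * Vector fields annihilated by a differential *)

Section Bracket.
Variable R : realType.

Lemma smooth_near_diff (V W : normedModType R) (U : set V) (f : V -> W)
    (x : V) : open U ->
  smooth_on U f -> U x -> \near x, differentiable f x.
Proof.
move=> oU sf Ux; have nU : nbhs x U by apply: open_nbhs_nbhs.
by apply: filterS nU => y; exact: smooth_on_diff.
Qed.

(** The product rule for the contraction of the differential of f with the
    field X; the symmetry of second derivatives puts the second-order term in
    the form 'D_(X x) ('D_w f) x. *)
Lemma derive_diff_along m (U : set 'rV[R]_m) (f : 'rV[R]_m -> R)
    (X : 'rV[R]_m -> 'rV[R]_m) (x w : 'rV[R]_m) : open U -> U x ->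
  smooth_on U f -> smooth_on U X ->
  'D_w (fun y => 'd f y (X y)) x = 'd f x ('D_w X x) + 'D_(X x) ('D_w f) x.
Proof.
move=> oU Ux sf sX.
have df := smooth_on_diff sf Ux.
have dX := smooth_on_diff sX Ux.
have dD v : differentiable ('D_v f) x := smooth_on_diff (smooth_on_derive v sf) Ux.
have dXi i : differentiable (fun y => X y 0 i) x := differentiable_rV_coord i dX.
pose T i : 'rV[R]_m -> R := (fun y => X y 0 i) * ('D_(delta_mx 0 i) f).
transitivity ('D_w (\sum_i T i) x).
  apply: near_eq_derive.
  have nU : nbhs x U by apply: open_nbhs_nbhs.
  apply: filterS nU => y Uy; rewrite (diff_rV_sum _ (smooth_on_diff sf Uy)).
  by rewrite fct_sumE.
rewrite derive_sum; last first.
  by move=> i; apply/diff_derivable/differentiableM; [exact: dXi|exact: dD].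
rewrite (diff_rV_sum _ df) (deriveE _ (dD w)) (diff_rV_sum _ (dD w)) -big_split.
apply: eq_bigr => i _ /=.
have eX : 'D_w X x 0 i = 'D_w (fun y => X y 0 i) x := derive_rV w i dX.
have eD : 'D_w ('D_(delta_mx 0 i) f) x = 'D_(delta_mx 0 i) ('D_w f) x.
  exact: (derive_comm (smooth_near_diff oU sf Ux) (dD _) (dD _)).
rewrite (deriveM (diff_derivable (dXi i)) (diff_derivable (dD _))).
rewrite eX eD.
move: ('D_w _ x) ('D__ _ x) ('D__ _ x) => a b c.
have -> : b *: a = a *: b by exact: (mulrC (b : R) (a : R)).
exact: addrC.
Qed.

Lemma diff_rV_coord (V : normedModType R) n (f : V -> 'rV[R]_n) x v i :
  differentiable f x ->
  'd f x v 0 i = 'd (fun y => f y 0 i) x v.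
Proof.
move=> df; rewrite -(deriveE _ df) (derive_rV _ _ df).
by rewrite (deriveE _ (differentiable_rV_coord i df)).
Qed.

(** Differentiating 'd f (X) = 0 along Y and 'd f (Y) = 0 along X expresses
    'd f ('d X (Y)) and 'd f ('d Y (X)) by second derivatives of f, which
    agree. *)
Lemma diff_bracket_eq0 m n (U : set 'rV[R]_m) (f : 'rV[R]_m -> 'rV[R]_n)
    (X Y : 'rV[R]_m -> 'rV[R]_m) (x : 'rV[R]_m) : open U -> U x ->
  smooth_on U f -> smooth_on U X -> smooth_on U Y ->
  (forall y, U y -> 'd f y (X y) = 0) -> (forall y, U y -> 'd f y (Y y) = 0) ->
  'd f x ('d Y x (X x) - 'd X x (Y x)) = 0.
Proof.
move=> oU Ux sf sX sY fX fY; apply/rowP => k.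
rewrite (diff_rV_coord _ _ (smooth_on_diff sf Ux)).
set g := fun y => f y 0 k; rewrite mxE.
have sg : smooth_on U g := (smooth_on_rV f oU).1 sf k.
have along Z w : smooth_on U Z -> (forall y, U y -> 'd f y (Z y) = 0) ->
    'd g x ('d Z x w) = - 'D_(Z x) ('D_w g) x.
  move=> sZ fZ; apply/eqP; rewrite -addr_eq0 -(deriveE _ (smooth_on_diff sZ Ux)).
  rewrite -(derive_diff_along _ oU Ux sg sZ).
  rewrite (@near_eq_derive _ _ _ _ (cst 0)) ?derive_cst//.
  have nU : nbhs x U by apply: open_nbhs_nbhs.
  apply: filterS nU => y Uy.
  by rewrite -(diff_rV_coord _ _ (smooth_on_diff sf Uy)) (fZ y Uy) mxE.
rewrite linearB (along Y _ sY fY) (along X _ sX fX) opprK addrC.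
apply/eqP; rewrite subr_eq0; apply/eqP.
apply: derive_comm (smooth_near_diff oU sg Ux) _ _.
  exact: smooth_on_diff (smooth_on_derive _ sg) Ux.
exact: smooth_on_diff (smooth_on_derive _ sg) Ux.
Qed.

End Bracket.

(** * The differential of a smooth map in charts *)

Section Maps.
Variables (R : realType) (m n : nat) (M : riemannian R m) (N : riemannian R n).
Variable F : M -> N.
Hypothesis sF : smooth_map F.
Implicit Types (X Y : vfield M).

Definition local_map (a : chart_index M) (b : chart_index N) :=
  chart b \o F \o param a.

Lemma preimage_dom_open (b : chart_index N) : open (F @^-1` dom b).
Proof. by move: sF => [/continuousP cF _]; apply: cF; exact: dom_open. Qed.

Lemma local_map_diff a b (p : M) : dom a p -> dom b (F p) ->
  differentiable (local_map a b) (chart a p).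
Proof.
move=> ap bp; have h : (chart a @` (dom a `&` (F @^-1` dom b))) (chart a p).
  by exists p.
exact: smooth_on_diff (sF.2 a b) h.
Qed.

(** The local expressions of F in different charts differ by the transition
    maps; the differential of F is thus independent of the charts. *)
Lemma local_map_change a a' b b' (p : M) v : dom a p -> dom a' p ->
  dom b (F p) -> dom b' (F p) ->
  'd (local_map a' b') (chart a' p) (dtrans a a' p v) =
  dtrans b b' (F p) ('d (local_map a b) (chart a p) v).
Proof.
move=> ap a'p bp b'p.
have dab := local_map_diff ap bp; have da'b' := local_map_diff a'p b'p.
have daa' := transition_diff ap a'p.
have dbb' := transition_diff bp b'p.
have e1 : (chart a' \o param a) (chart a p) = chart a' p by rewrite /= chartK.
have e2 : local_map a b (chart a p) = chart b (F p) by rewrite /local_map /= chartK.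
transitivity ('d (local_map a' b' \o (chart a' \o param a)) (chart a p) v).
  exact: esym (diff_comp_at v e1 daa' da'b').
transitivity ('d ((chart b' \o param b) \o local_map a b) (chart a p) v); last first.
  exact: (diff_comp_at v e2 dab dbb').
apply: near_eq_diff; last by apply: differentiable_comp daa' _; rewrite e1.
apply: (near_chart (openI (dom_open a') (preimage_dom_open b)) ap (conj a'p bp)).
by move=> q aq [a'q bq]; rewrite /local_map /= !chartK.
Qed.

Lemma pushforwardE (p : M) v :
  pushforward F p v = 'd (local_map (base p) (base (F p))) (chart (base p) p) v.
Proof.
exact: (lfunE ('d (local_map (base p) (base (F p))) (chart (base p) p)) v).
Qed.

Lemma pushforward_in_chart a b X (p : M) : dom a p -> dom b (F p) ->
  dtrans (base (F p)) b (F p) (pushforward F p (X p)) =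
  'd (local_map a b) (chart a p) (in_chart a X (chart a p)).
Proof.
move=> ap bp; rewrite pushforwardE (in_chartE X ap).
exact: esym (local_map_change (X p) (baseP p) ap (baseP (F p)) bp).
Qed.

Lemma pushforward_coord a b X (p : M) : dom a p -> dom b (F p) ->
  pushforward F p (X p) =
  coord_field b ('d (local_map a b) (chart a p) (in_chart a X (chart a p))) (F p).
Proof.
move=> ap bp; have Fp0 := baseP (F p).
rewrite -(pushforward_in_chart X ap bp) -[RHS]/(dtrans b (base (F p)) (F p) _).
by rewrite (dtrans_comp _ Fp0 bp Fp0) (dtrans_id _ Fp0).
Qed.

(** Vertical fields are F-related to the zero field. *)
Lemma lie_bracket_vertical X Y : smooth_field X -> smooth_field Y ->
  (forall p, X p \in vertical F p) -> (forall p, Y p \in vertical F p) ->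
  forall p, lie_bracket X Y p \in vertical F p.
Proof.
move=> /smooth_fieldP sX /smooth_fieldP sY vX vY p.
rewrite memv_ker pushforwardE; apply/eqP.
set a := base p; set b := base (F p).
pose O := chart a @` (dom a `&` (F @^-1` dom b)).
have oO : open O by apply: chart_image_open; exact: preimage_dom_open.
have Op : O (chart a p) by exists p => //; split; exact: baseP.
have Oa : O `<=` chart a @` dom a by move=> _ [q [aq _] <-]; exists q.
have along Z : (forall p, Z p \in vertical F p) ->
    forall y, O y -> 'd (local_map a b) y (in_chart a Z y) = 0.
  move=> vZ _ [q [aq bq] <-]; rewrite -(pushforward_in_chart Z aq bq).
  by have := vZ q; rewrite memv_ker => /eqP ->; rewrite linear0.
exact: (diff_bracket_eq0 oO Op (sF.2 a b) (smooth_on_sub Oa (sX a))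
  (smooth_on_sub Oa (sY a)) (along X vX) (along Y vY)).
Qed.

(** In charts of M and N the expression is a sum of products of components of
    F_* X, of components of F_* v, and of metric coefficients of N composed
    with F. *)
Lemma smooth_pullback_metric a X v : smooth_field X ->
  smooth_on (chart a @` dom a) (fun x =>
    metric (F (param a x)) (pushforward F (param a x) (X (param a x)))
      (pushforward F (param a x) (coord_field a v (param a x))) : R).
Proof.
move=> /smooth_fieldP sX; apply: smooth_on_local => _ [p ap <-].
set b := base (F p).
pose O := chart a @` (dom a `&` (F @^-1` dom b)).
have oO : open O by apply: chart_image_open; exact: preimage_dom_open.
have Op : O (chart a p) by exists p => //; split=> //; exact: baseP.
have Oa : O `<=` chart a @` dom a by move=> _ [q [aq _] <-]; exists q.
exists O => //.
have sf : smooth_on O (local_map a b) := sF.2 a b.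
pose c x := 'd (local_map a b) x (in_chart a X x).
pose d x := 'd (local_map a b) x v.
have sc : forall i, smooth_on O (fun x => c x 0 i).
  apply/(smooth_on_rV _ oO).
  exact: smooth_on_diff_along oO sf (smooth_on_sub Oa (sX a)).
have sd : forall i, smooth_on O (fun x => d x 0 i).
  apply/(smooth_on_rV _ oO).
  exact: smooth_on_diff_along oO sf (@smooth_on_cst _ _ _ _ v).
pose G i j (y : 'rV[R]_n) : R := metric (param b y)
   (coord_field b (delta_mx 0 i) (param b y)) (coord_field b (delta_mx 0 j) (param b y)).
exists (fun x => \sum_i \sum_j c x 0 i * (d x 0 j * (G i j \o local_map a b) x)).
  apply: smooth_on_sum => [|i _]; first exact: oO.
  apply: smooth_on_sum => [|j _]; first exact: oO.
  apply: smooth_onM (oO) (sc i) _; apply: smooth_onM (oO) (sd j) _.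
  apply: (smooth_on_comp oO (@chart_open _ _ N b) _ sf) (@metric_smooth _ _ N b _ _).
  by move=> _ [q [aq bq] <-]; exists (F q) => //=; rewrite /local_map /= chartK.
move=> x /[1!inE] -[q [aq bq] <-]; rewrite (chartK aq).
rewrite (pushforward_coord X aq bq) (pushforward_coord (coord_field a v) aq bq).
rewrite (in_chart_coord _ aq) -/(c _) -/(d _).
rewrite (coord_field_sum _ (c _)) (coord_field_sum _ (d _)) linear_sumlz.
apply: eq_bigr => i _; rewrite linear_sumr; apply: eq_bigr => j _ /=.
by rewrite linearZl_LR linearZr_LR /= /G /local_map /= (chartK aq) (chartK bq).
Qed.

End Maps.

(** * Projections along orthogonal complements *)

Section Projections.
Variables (K : fieldType) (vT : vectType K).
Implicit Types (U V : {vspace vT}) (w : vT).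

Lemma daddv_pi_eq0 U V w : (U :&: V = 0)%VS -> w \in V -> daddv_pi U V w = 0.
Proof.
move=> UV wV; have VU : (V :&: U = 0)%VS by rewrite capvC.
have wUV : w \in (U + V)%VS by apply: subvP wV; exact: addvSr.
have := daddv_pi_add UV wUV; rewrite (daddv_pi_id VU wV) => /eqP.
by rewrite -[X in _ == X]add0r (inj_eq (addIr _)) => /eqP.
Qed.

End Projections.

Section Orthogonal.
Variables (R : realType) (n : nat) (M : riemannian R n).
Implicit Types (p : M) (U V : {vspace 'rV[R]_n}).

(** Each vector of s imposes one linear equation.  With V the full space this
    bounds the dimension of an orthogonal complement from below. *)
Lemma dim_cap_orth_span p V (s : seq 'rV[R]_n) :
  (\dim V - size s <= \dim (V :&: orth p (span s)))%N.
Proof.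
elim: s => [|u s IH] /=.
  by rewrite subn0 span_nil /orth orthov0 capvf.
rewrite span_cons.
have sub : (V :&: orth p (span s) :&: orth p <[u]> <= V :&: orth p (<[u]> + (span s)))%VS.
  by rewrite -capvA capvS// /orth orthovD capvSr capvSl.
apply: leq_trans (dimvS sub).
apply: leq_trans (leq_dim_orthov1 (metric p) u (V :&: orth p (span s))).
by rewrite subnS -!subn1 leq_sub2r.
Qed.

Lemma orth_cap p U : (U :&: orth p U = 0)%VS.
Proof.
apply/eqP; rewrite -subv0; apply/subvP => u /memv_capP[uU /mem_orthovP uo].
by rewrite memv0; apply/eqP/(@metric_eq0 _ _ M p)/uo.
Qed.

Lemma orth_add p U : (U + orth p U = fullv)%VS.
Proof.
apply/eqP; rewrite eqEdim subvf /= (dimv_disjoint_sum (orth_cap p U)).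
have := dim_cap_orth_span p fullv (vbasis U).
by rewrite (span_basis (vbasisP U)) size_tuple capfv leq_subLR.
Qed.

Lemma orthP p U v : reflect (forall u, u \in U -> metric p v u = 0) (v \in orth p U).
Proof. exact: mem_orthovP. Qed.

End Orthogonal.

(** * The horizontal projection of a Riemannian map *)

Section HorizontalProjection.
Variables (R : realType) (m n : nat) (M : riemannian R m) (N : riemannian R n).
Variable F : M -> N.
Implicit Types (X Y : vfield M) (p : M).

Lemma vproj_vertical X p : vproj F X p \in vertical F p.
Proof. exact: memv_pi. Qed.

Lemma hproj_horizontal X p : hproj F X p \in horizontal F p.
Proof. exact: memv_pi. Qed.

Lemma vertical_horizontal0 p : (vertical F p :&: horizontal F p = 0)%VS.
Proof. exact: orth_cap. Qed.

Lemma vproj_hproj X p : vproj F X p + hproj F X p = X p.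
Proof.
apply: daddv_pi_add; first exact: vertical_horizontal0.
by rewrite orth_add memvf.
Qed.

Lemma vproj_id X p : X p \in vertical F p -> vproj F X p = X p.
Proof. exact: daddv_pi_id (vertical_horizontal0 p). Qed.

Lemma vproj_eq0 X p : X p \in horizontal F p -> vproj F X p = 0.
Proof. exact: daddv_pi_eq0 (vertical_horizontal0 p). Qed.

Lemma hproj_id X p : X p \in horizontal F p -> hproj F X p = X p.
Proof. by move=> hX; rewrite -[RHS](vproj_hproj X p) vproj_eq0// add0r. Qed.

Lemma metric_horizontal p u v : u \in horizontal F p -> v \in vertical F p ->
  metric p u v = 0.
Proof. by move=> /orthP; exact. Qed.

Hypothesis rF : riemannian_map F.

(** F_* kills vertical parts and is isometric on horizontal ones, and the
    horizontal part of X pairs trivially with the vertical part of Y. *)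
Lemma metric_hproj X Y p : metric p (hproj F X p) (Y p) =
  metric (F p) (pushforward F p (X p)) (pushforward F p (Y p)).
Proof.
have pushE Z : pushforward F p (Z p) = pushforward F p (hproj F Z p).
  have pv : pushforward F p (vproj F Z p) = 0.
    by apply/eqP; rewrite -memv_ker; exact: vproj_vertical.
  by rewrite -{1}(vproj_hproj Z p) linearD /= pv add0r.
rewrite (pushE X) (pushE Y) (rF.2 p).1 ?hproj_horizontal//.
rewrite -{1}(vproj_hproj Y p) linearDr /=.
by rewrite (metric_horizontal (hproj_horizontal X p) (vproj_vertical Y p)) add0r.
Qed.

(** No local frame of the vertical spaces enters: the metric products of the
    projected field with coordinate fields are values of the pulled-back metric. *)
Lemma smooth_hproj X : smooth_field X -> smooth_field (hproj F X).
Proof.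
move=> sX; apply: smooth_field_by_metric => a v.
have sG := smooth_pullback_metric rF.1 (a := a) v sX.
apply: (eq_smooth_on (@chart_open _ _ M a) _ sG).
by move=> x _; rewrite /= (metric_hproj X (coord_field a v)).
Qed.

Lemma smooth_vproj X : smooth_field X -> smooth_field (vproj F X).
Proof.
move=> sX; have -> : vproj F X = (fun p => X p - hproj F X p).
  by apply/funext => p; rewrite -(vproj_hproj X p) addrK.
by apply: smooth_fieldB => //; exact: smooth_hproj.
Qed.

End HorizontalProjection.

(** * The splitting of the vertical bundle *)

Section Slant.
Variables (R : realType) (m n : nat) (M : riemannian R m) (N : riemannian R n).
Variables (F : M -> N) (D1 : M -> {vspace 'rV[R]_m}).
Hypothesis D1V : forall p, (D1 p <= vertical F p)%VS.
Implicit Types (X Y : vfield M) (p : M).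

Lemma D1_slant0 p : (D1 p :&: slant_part F D1 p = 0)%VS.
Proof. by rewrite capvC -capvA [X in (_ :&: X)%VS]capvC orth_cap capv0. Qed.

Lemma D1_slant_add p v : v \in vertical F p -> v \in (D1 p + slant_part F D1 p)%VS.
Proof.
move=> vV; have vf : v \in (D1 p + orth p (D1 p))%VS by rewrite orth_add memvf.
have [d dD [w wo vE]] := memv_addP vf; rewrite vE memv_add// memv_cap wo andbT.
have -> : w = v - d by rewrite vE addrC addKr.
by rewrite rpredB//; exact: subvP (D1V p) _ dD.
Qed.

(** An isometry preserving D1 maps vectors orthogonal to D1 to vectors
    orthogonal to D1, and removing the horizontal part keeps this since D1 is
    vertical. *)
Lemma vertical_endo_slant (A : M -> 'End('rV[R]_m)) p z :
  isometric A -> (A p @: D1 p)%VS = D1 p -> z \in slant_part F D1 p ->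
  daddv_pi (vertical F p) (horizontal F p) (A p z) \in slant_part F D1 p.
Proof.
move=> iA AD /memv_capP[_ /orthP zo]; rewrite memv_cap memv_pi; apply/orthP => d dD.
have d' : d \in (A p @: D1 p)%VS by rewrite AD.
have [c cD cE] := memv_imgP d'.
have := vproj_hproj F (fun q => A q (z : 'rV[R]_m)) p; rewrite /vproj /hproj.
set x := daddv_pi _ _ _; set y := daddv_pi _ _ _ => xyE.
have yo : metric p y d = 0.
  by apply: (@metric_horizontal _ _ _ _ _ F) (memv_pi _ _ _) (subvP (D1V p) _ dD).
have : metric p (x + y) d = 0 by rewrite xyE cE iA zo.
by rewrite linearDl /= yo addr0.
Qed.

(** Writing z = d + w along D1 and its complement, the left-hand side is
    A d, and A is injective. *)
Lemma proj_D1_endo (A : M -> 'End('rV[R]_m)) p z :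
  isometric A -> (A p @: D1 p)%VS = D1 p -> z \in vertical F p ->
  daddv_pi (D1 p) (slant_part F D1 p)
    (daddv_pi (vertical F p) (horizontal F p) (A p z)) = 0 <->
  z \in slant_part F D1 p.
Proof.
move=> iA AD zV; split=> [pz|zS]; last first.
  by apply: daddv_pi_eq0 (D1_slant0 p) _; exact: vertical_endo_slant.
have [d dD [w wS zE]] := memv_addP (D1_slant_add zV).
have AdD : A p d \in D1 p by have := memv_img (A p) dD; rewrite AD.
move: pz; rewrite zE !linearD /= (daddv_pi_id (vertical_horizontal0 F p)); last first.
  exact: subvP (D1V p) _ AdD.
rewrite (daddv_pi_id (D1_slant0 p) AdD).
rewrite (daddv_pi_eq0 (D1_slant0 p) (vertical_endo_slant iA AD wS)) addr0 => Ad0.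
suff -> : d = 0 by rewrite add0r.
by apply: (@metric_eq0 _ _ M p); rewrite -(iA p) Ad0 linear0r.
Qed.

End Slant.

(** * Integrability of the slant distribution *)

Section Connection.
Variables (R : realType) (m n : nat) (M : riemannian R m) (N : riemannian R n).
Variables (nabla : vfield M -> vfield M -> vfield M) (F : M -> N).
Variables (D1 : M -> {vspace 'rV[R]_m}).
Hypotheses (nablaP : levi_civita nabla) (rF : riemannian_map F).
Hypothesis D1V : forall p, (D1 p <= vertical F p)%VS.
Implicit Types (X Y : vfield M) (p : M).

Lemma nabla0 X p : smooth_field X -> nabla X (fun=> 0) p = 0.
Proof.
move=> sX; have s0 : smooth_field (fun _ : M => 0 : 'rV[R]_m).
  have -> : (fun _ : M => 0 : 'rV[R]_m) = (fun q => X q - X q).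
    by apply/funext => q; rewrite subrr.
  exact: smooth_fieldB.
have := nablaDr nablaP sX s0 s0 p.
have -> : (fun _ : M => 0 + 0 : 'rV[R]_m) = (fun=> 0).
  by apply/funext => q; rewrite addr0.
by move/eqP; rewrite -[X in X == _]addr0 (inj_eq (addrI _)) => /eqP.
Qed.

(** For a vertical X and a horizontal second argument only the second
    summand of the tensor T survives. *)
Lemma tensorT_omega (A : M -> 'End('rV[R]_m)) X Y p :
  smooth_field X -> (forall q, X q \in vertical F q) ->
  tensorT F nabla X (omega F A Y) p = vproj F (nabla X (omega F A Y)) p.
Proof.
move=> sX vX; rewrite /tensorT.
have -> : vproj F X = X by apply/funext => q; exact: vproj_id.
have -> : vproj F (omega F A Y) = (fun=> 0).
  by apply/funext => q; apply: vproj_eq0; exact: hproj_horizontal.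
have -> : hproj F (omega F A Y) = omega F A Y.
  by apply/funext => q; apply: hproj_id; exact: hproj_horizontal.
by rewrite /hproj (nabla0 p sX) linear0 add0r.
Qed.

(** All four terms recombine because A Y = phi Y + omega Y with both parts
    smooth, and because A commutes with the covariant derivative. *)
Lemma slant_expression (A : M -> 'End('rV[R]_m)) X Y p :
  smooth_endo A -> parallel nabla A -> smooth_field X -> smooth_field Y ->
  (forall q, X q \in vertical F q) -> (forall q, Y q \in vertical F q) ->
  nabla_hat F nabla X (phi F A Y) p - nabla_hat F nabla Y (phi F A X) p
    + tensorT F nabla X (omega F A Y) p - tensorT F nabla Y (omega F A X) p
  = daddv_pi (vertical F p) (horizontal F p) (A p (lie_bracket X Y p)).
Proof.
move=> sA pA sX sY vX vY; rewrite !tensorT_omega// /nabla_hat /vproj.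
have half Z W : smooth_field Z -> smooth_field W ->
    A p (nabla Z W p) = nabla Z (phi F A W) p + nabla Z (omega F A W) p.
  move=> sZ sW; have sAW := smooth_endo_field sA sW.
  rewrite -(pA Z W sZ sW) -(nablaDr nablaP sZ (smooth_vproj rF sAW) (smooth_hproj rF sAW)).
  by congr nabla; apply/funext => q; rewrite /phi /omega vproj_hproj.
rewrite -(nabla_torsion_free nablaP sX sY) (linearB (A p)) /= !half//.
move: (nabla X _ p) (nabla X _ p) (nabla Y _ p) (nabla Y _ p) => a b c d.
by rewrite linearB !linearD /= [RHS]addrACA !addrA.
Qed.

Lemma integrable_slant_condition (A : M -> 'End('rV[R]_m)) :
  smooth_endo A -> parallel nabla A -> isometric A ->
  (forall p, (A p @: D1 p)%VS = D1 p) ->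
  integrable_distribution (slant_part F D1) <-> slant_condition F nabla D1 A.
Proof.
move=> sA pA iA AD.
have slantV p v : v \in slant_part F D1 p -> v \in vertical F p by case/memv_capP.
have key X Y p : section_of (slant_part F D1) X -> section_of (slant_part F D1) Y ->
    proj_D1 F D1 (fun q =>
      nabla_hat F nabla X (phi F A Y) q - nabla_hat F nabla Y (phi F A X) q
      + tensorT F nabla X (omega F A Y) q - tensorT F nabla Y (omega F A X) q) p = 0
    <-> lie_bracket X Y p \in slant_part F D1 p.
  move=> [sX dX] [sY dY]; have vX q := slantV q _ (dX q); have vY q := slantV q _ (dY q).
  rewrite /proj_D1 slant_expression//.
  apply: proj_D1_endo => //; exact: (lie_bracket_vertical rF.1).
split=> h X Y hX hY; first by move=> p; apply/(key X Y p hX hY); exact: (h X Y hX hY).2.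
have [[sX _] [sY _]] := (hX, hY).
split=> [|p]; last exact/(key X Y p hX hY)/h.
have -> : lie_bracket X Y = (fun p => nabla X Y p - nabla Y X p).
  by apply/funext => p; rewrite (nabla_torsion_free nablaP).
by apply: smooth_fieldB; apply: (nabla_smooth nablaP).
Qed.

End Connection.

Theorem theorem3p5 (R : realType) (m n : nat)
    (M : riemannian R m) (N : riemannian R n)
    (nabla : vfield M -> vfield M -> vfield M)
    (I J K : M -> 'End('rV[R]_m)) (F : M -> N)
    (D1 : M -> {vspace 'rV[R]_m})
    (nablaP : levi_civita nabla) (hk : hyperkahler nabla I J K)
    (hF : h_semi_slant F I J K D1) :
  [<-> integrable_distribution (slant_part F D1);
       slant_condition F nabla D1 I;
       slant_condition F nabla D1 J;
       slant_condition F nabla D1 K].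
Proof.
case: hF => rF _ D1V [[ID _] [JD _] [KD _]].
have [sI sJ sK] := hk_smooth hk.
have [pI pJ pK] := hk_parallel hk.
have [iI iJ iK] := hk_metric hk.
have eI := integrable_slant_condition nablaP rF D1V sI pI iI ID.
have eJ := integrable_slant_condition nablaP rF D1V sJ pJ iJ JD.
have eK := integrable_slant_condition nablaP rF D1V sK pK iK KD.
tfae.
- exact: eI.1.
- by move/eI.2/eJ.1.
- by move/eJ.2/eK.1.
- exact: eK.2.
Qed.
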